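(* Let $G$ be the caterpillar $C(l;m_1,m_2,\ldots,m_l)$ with $l\ge 2$, $m_1,m_l\ge 1$ and $m_2,\ldots,m_{l-1}\ge 0$. Then $\chi_p(G)=3$ if and only if $G$ belongs to (i.e. is isomorphic to a member of) $\mathcal{G}_1\cup\mathcal{G}_2\cup\cdots\cup\mathcal{G}_7$, where (all unspecified $m_i$ being arbitrary, subject to $m_1,m_l\ge 1$): $\mathcal{G}_1$: caterpillars $C(4k;m_1,\ldots,m_{4k})$, $k\ge 1$, with $m_i=0$ for every odd $i$ with $3\le i\le 4k-1$; $\mathcal{G}_2$: caterpillars $C(4k+1;m_1,\ldots,m_{4k+1})$, $k\ge 1$, with $m_1=1$ and $m_i=0$ for every odd $i$ with $3\le i\le 4k-1$; $\mathcal{G}_3$: caterpillars $C(4k+1;m_1,\ldots,m_{4k+1})$, $k\ge 1$, with $m_i=0$ for every even $i$ with $2\le i\le 4k$; $\mathcal{G}_4$: caterpillars $C(4k+2;m_1,\ldots,m_{4k+2})$, $k\ge 0$, with $m_i=0$ for every odd $i$ with $3\le i\le 4k+1$; $\mathcal{G}_5$: caterpillars $C(4k+3;m_1,\ldots,m_{4k+3})$, $k\ge 1$, with $m_i=0$ for every odd $i$ with $3\le i\le 4k+1$; $\mathcal{G}_6$: caterpillars $C(3;m_1,m_2,1)$; $\mathcal{G}_7$: caterpillars $C(4k+3;m_1,\ldots,m_{4k+3})$, $k\ge 0$, with $m_i=0$ for every even $i$ with $2\le i\le 4k+2$.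
   Context: A packing $k$-coloring of a graph $H$ is a map $c:V(H)\to\{1,\ldots,k\}$ such that any two distinct vertices $u,v$ with $c(u)=c(v)=i$ satisfy $d_H(u,v)\ge i+1$. The packing chromatic number $\chi_p(H)$ is the least such $k$. A caterpillar $C(l;m_1,\ldots,m_l)$ is the tree consisting of a path $v_1v_2\cdots v_l$ (the backbone) together with, for each $i\in\{1,\ldots,l\}$, exactly $m_i$ leaves (degree-one vertices) attached to $v_i$; removing all pendant edges leaves the backbone path. Caterpillars are regarded as graphs, so membership in a family is up to graph isomorphism (in particular, $C(l;m_1,\ldots,m_l)\cong C(l;m_l,\ldots,m_1)$). *)

(* Defs.v *)
From mathcomp Require Import all_boot.

Set Implicit Arguments.
Unset Strict Implicit.
Unset Printing Implicit Defensive.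

Record sgraph := SGraph {
  vertex :> finType;
  adj : rel vertex;
  adj_sym : symmetric adj;
  adj_irrefl : irreflexive adj }.

Definition isomorphic (G H : sgraph) : Prop :=
  exists2 f : G -> H, bijective f & forall x y, adj (f x) (f y) = adj x y.

Definition walk (H : sgraph) (n : nat) (u v : H) : bool :=
  [exists p : n.-tuple H, path (@adj H) u p && (last u p == v)].

(* The least length of a walk from u to v. A shortest walk has fewer than #|H|
   edges; the value is #|H| when u and v lie in different components, so
   infinite distances must be handled separately. *)
Definition gdist (H : sgraph) (u v : H) : nat :=
  find (fun n => walk n u v) (iota 0 #|H|).

(* The colors 1, ..., k are represented by c v + 1 with c v : 'I_k; vertices in
   different components are at infinite distance. *)
Definition packing_coloring (H : sgraph) (k : nat) (c : {ffun H -> 'I_k}) :=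
  [forall u, forall v,
    [&& u != v, c u == c v & connect (@adj H) u v]
      ==> ((c u).+1 + 1 <= gdist u v)].

Definition packing_colorable (H : sgraph) (k : nat) : bool :=
  [exists c : {ffun H -> 'I_k}, packing_coloring c].

Lemma ex_packing_colorable (H : sgraph) : exists k, packing_colorable H k.
Proof.
exists #|H|; apply/existsP; exists [ffun v => enum_rank v].
apply/forallP => u; apply/forallP => v; apply/implyP => /and3P[uv + _].
by rewrite !ffunE => /eqP/enum_rank_inj/eqP; rewrite (negPf uv).
Qed.

Definition packing_chromatic (H : sgraph) : nat :=
  ex_minn (ex_packing_colorable H).

(* inl i is the backbone vertex v_{i+1}; inr (existT i j) is the j-th leaf
   attached to v_{i+1}. Backbone indices in m are 1-based: only the values
   m 1, ..., m l matter. *)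
Definition cat_vertex (l : nat) (m : nat -> nat) : finType :=
  ('I_l + {i : 'I_l & 'I_(m i.+1)})%type.

Definition cat_adj (l : nat) (m : nat -> nat) : rel (cat_vertex l m) :=
  fun x y =>
    match x, y with
    | inl i, inl j => (i.+1 == j) || (j.+1 == i)
    | inl i, inr b => tag b == i
    | inr a, inl j => tag a == j
    | inr _, inr _ => false
    end.

Lemma cat_adj_sym (l : nat) (m : nat -> nat) : symmetric (@cat_adj l m).
Proof. by case=> [i|a] [j|b] //=; rewrite orbC. Qed.

Lemma cat_adj_irrefl (l : nat) (m : nat -> nat) : irreflexive (@cat_adj l m).
Proof. by case=> [i|a] //=; rewrite orbb gtn_eqF. Qed.

Definition caterpillar (l : nat) (m : nat -> nat) : sgraph :=
  SGraph (@cat_adj_sym l m) (@cat_adj_irrefl l m).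

Definition family1 (G : sgraph) : Prop :=
  exists (k : nat) (m : nat -> nat),
    [/\ 1 <= k, 1 <= m 1 /\ 1 <= m (4 * k),
        forall i, odd i -> 3 <= i <= 4 * k - 1 -> m i = 0
      & isomorphic G (caterpillar (4 * k) m)].

Definition family2 (G : sgraph) : Prop :=
  exists (k : nat) (m : nat -> nat),
    [/\ 1 <= k, m 1 = 1 /\ 1 <= m (4 * k + 1),
        forall i, odd i -> 3 <= i <= 4 * k - 1 -> m i = 0
      & isomorphic G (caterpillar (4 * k + 1) m)].

Definition family3 (G : sgraph) : Prop :=
  exists (k : nat) (m : nat -> nat),
    [/\ 1 <= k, 1 <= m 1 /\ 1 <= m (4 * k + 1),
        forall i, ~~ odd i -> 2 <= i <= 4 * k -> m i = 0
      & isomorphic G (caterpillar (4 * k + 1) m)].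

Definition family4 (G : sgraph) : Prop :=
  exists (k : nat) (m : nat -> nat),
    [/\ 1 <= m 1 /\ 1 <= m (4 * k + 2),
        forall i, odd i -> 3 <= i <= 4 * k + 1 -> m i = 0
      & isomorphic G (caterpillar (4 * k + 2) m)].

Definition family5 (G : sgraph) : Prop :=
  exists (k : nat) (m : nat -> nat),
    [/\ 1 <= k, 1 <= m 1 /\ 1 <= m (4 * k + 3),
        forall i, odd i -> 3 <= i <= 4 * k + 1 -> m i = 0
      & isomorphic G (caterpillar (4 * k + 3) m)].

Definition family6 (G : sgraph) : Prop :=
  exists m : nat -> nat,
    [/\ 1 <= m 1, m 3 = 1 & isomorphic G (caterpillar 3 m)].

Definition family7 (G : sgraph) : Prop :=
  exists (k : nat) (m : nat -> nat),
    [/\ 1 <= m 1 /\ 1 <= m (4 * k + 3),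
        forall i, ~~ odd i -> 2 <= i <= 4 * k + 2 -> m i = 0
      & isomorphic G (caterpillar (4 * k + 3) m)].

(* Main.v *)
(** Prolong the backbone by a leaf at each end to an induced path w_0 ... w_(l+1).
    In a packing 3-coloring, a vertex of color 1 has at most two neighbors, since
    they are pairwise at distance 2 and share the colors 2 and 3; so inner
    backbone vertices of color 1 carry no leaf, and v_1, v_l carry exactly one if
    they have color 1. Two consecutive inner vertices cannot both avoid color 1,
    so color 1 alternates on v_2 ... v_(l-1) and the other vertices of that stretch
    are colored 2, 3, 2, 3, ... in turn. The only freedom is at the ends, where
    v_1 v_2 (or v_l v_(l-1)) may be colored 2 3; comparing both ends modulo 4 gives
    the families. Conversely these patterns are colorings once every leaf of a
    vertex not colored 1 gets color 1.

    Colors 1, 2, 3 are encoded as 0, 1, 2, as in [packing_coloring]. *)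

Require Import Defs.
From mathcomp Require Import all_boot.
From mathcomp Require Import zify.

Set Implicit Arguments.
Unset Strict Implicit.
Unset Printing Implicit Defensive.

Section Distance.

Variable H : sgraph.
Implicit Types (u v w : H) (n : nat).

Lemma walkP n u v :
  reflect (exists p, [/\ size p = n, path (@adj H) u p & last u p = v])
          (walk n u v).
Proof.
apply: (iffP existsP) => [[p /andP[up /eqP lp]]|[p [sp up lp]]].
  by exists p; rewrite size_tuple.
have sp' : size p == n by apply/eqP.
by exists (Tuple sp'); rewrite /= up lp eqxx.
Qed.

Lemma walk_cons n u v w : adj u v -> walk n v w -> walk n.+1 u w.
Proof.
move=> uv /walkP[p [sp vp lp]]; apply/walkP; exists (v :: p).
by rewrite /= sp uv.
Qed.

Lemma walk0 u : walk 0 u u.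
Proof. by apply/walkP; exists [::]. Qed.

Lemma walk_connect n u v : walk n u v -> connect (@adj H) u v.
Proof. by case/walkP=> p [_ up <-]; apply/connectP; exists p. Qed.

Lemma gdist_le n u v : walk n u v -> gdist u v <= n.
Proof.
move=> uv; rewrite /gdist leqNgt; apply/negP => lt_n.
have n_lt : n < #|H|.
  by rewrite (leq_trans lt_n) // -{2}(size_iota 0 #|H|) find_size.
by have := before_find 0 lt_n; rewrite nth_iota // add0n uv.
Qed.

Lemma walk_gdist u v : connect (@adj H) u v -> walk (gdist u v) u v.
Proof.
case/connectP=> p /shortenP[q uq Uq _ ->].
have hq : size q < #|H|.
  by rewrite -[(size q).+1]/(size (u :: q)) -(card_uniqP Uq) max_card.
have ex : has (fun n => walk n u (last u q)) (iota 0 #|H|).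
  apply/hasP; exists (size q); first by rewrite mem_iota.
  by apply/walkP; exists q.
have := nth_find 0 ex; rewrite nth_iota //.
by have := ex; rewrite has_find size_iota.
Qed.

Lemma walk_lipschitz (p : H -> nat) n u v :
  (forall x y, adj x y -> p y <= (p x).+1) -> walk n u v ->
  p u <= p v + n /\ p v <= p u + n.
Proof.
move=> lip /walkP[q [<- + <-]] {n v}.
elim: q u => [|v q IH] u /=; first by rewrite addn0.
case/andP=> uv /IH[]; have := lip u v uv; have := lip v u.
by rewrite adj_sym => /(_ uv); lia.
Qed.

Lemma packing_far k (c : {ffun H -> 'I_k}) n u v :
  packing_coloring c -> u != v -> walk n u v -> c u = c v -> c u + 2 <= n.
Proof.
move=> /forallP/(_ u)/forallP/(_ v)/implyP pc uv w_uv c_uv.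
have := gdist_le w_uv; move: pc; rewrite uv c_uv eqxx (walk_connect w_uv).
by move=> /(_ isT); lia.
Qed.

End Distance.

Lemma isomorphic_refl G : isomorphic G G.
Proof. by exists id => //; exists id. Qed.

Lemma isomorphic_packing_colorable (G H : sgraph) k :
  isomorphic G H -> packing_colorable H k -> packing_colorable G k.
Proof.
case=> f /bij_inj f_inj f_adj /existsP[c pc].
apply/existsP; exists [ffun x => c (f x)].
apply/forallP=> u; apply/forallP=> v; apply/implyP=> /and3P[uv].
rewrite !ffunE => /eqP c_uv /walk_gdist/walkP[p [sp up lp]].
have w : walk (gdist u v) (f u) (f v).
  apply/walkP; exists (map f p); rewrite size_map last_map lp; split=> //.
  rewrite path_map; apply: sub_path up => x y /= xy.
  by rewrite f_adj.
have := packing_far pc _ w c_uv; rewrite (inj_eq f_inj) => /(_ uv).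
by rewrite addSnnS.
Qed.

Lemma packing_chromatic_eq (H : sgraph) k :
  packing_colorable H k -> (forall j, j < k -> ~~ packing_colorable H j) ->
  packing_chromatic H = k.
Proof.
move=> Hk min_k; rewrite /packing_chromatic; case: ex_minnP => n Hn le_n.
apply/eqP; rewrite eqn_leq le_n //= leqNgt; apply/negP => /min_k.
by rewrite Hn.
Qed.

Section Alternation.

Variables (l : nat) (a : nat -> nat).
Hypothesis a_lt3 : forall i, a i < 3.
Hypothesis a_far : forall i j, i < j <= l.+1 -> a i = a j -> a i + 2 <= j - i.

Lemma color_neq1 i : i <= l -> a i != a i.+1.
Proof. by move=> hi; apply/eqP => /(a_far (i := i)); lia. Qed.

Lemma color_neq2 i : i < l -> a i != 0 -> a i != a i.+2.
Proof. by move=> hi ai; apply/eqP => /(a_far (i := i)); lia. Qed.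

Lemma color_neq3 i : i.+1 < l -> a i = 2 -> a i.+3 != 2.
Proof. by move=> hi ai; apply/eqP => ai3; have := @a_far i i.+3; lia. Qed.

(* If colours 2, 3 occur on consecutive inner vertices, the vertex before the 2
   has colour 1 and the one before it admits no colour. *)
Lemma color1_alternates i :
  2 <= i -> i.+1 < l -> (a i.+1 == 0) = ~~ (a i == 0).
Proof.
case: i => [|[|i]] // _ hi.
have := @color_neq3 i ltac:(lia); have := @color_neq3 i.+2 ltac:(lia).
have := @color_neq2 i ltac:(lia); have := @color_neq2 i.+1 ltac:(lia).
have := @color_neq2 i.+2 ltac:(lia); have := @color_neq2 i.+3 ltac:(lia).
have := @color_neq1 i ltac:(lia); have := @color_neq1 i.+1 ltac:(lia).
have := @color_neq1 i.+2 ltac:(lia); have := @color_neq1 i.+3 ltac:(lia).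
have := @color_neq1 i.+4 ltac:(lia).
have := a_lt3 i; have := a_lt3 i.+1; have := a_lt3 i.+2; have := a_lt3 i.+3.
have := a_lt3 i.+4; have := a_lt3 i.+4.+1.
move: (a i) (a i.+1) (a i.+2) (a i.+3) (a i.+4) (a i.+4.+1).
by do 6!case=> [|[|[|?]]] //=; intuition.
Qed.

Lemma color1_parity i :
  2 <= i < l -> (a i == 0) = (a 2 == 0) (+) odd i.
Proof.
elim: i => [|i IH] // hi; case: (ltngtP i.+1 2) hi => // [h|[->]] hi.
  rewrite color1_alternates ?IH /= ?addbN //; lia.
by rewrite addbF.
Qed.

Lemma color1_at_an_end k : 0 < k -> l = 4 * k + 1 ->
  a 2 != 0 -> (a 1 == 0) || (a l == 0).
Proof.
move=> k0 lE a2; apply/negPn/negP; rewrite negb_or => /andP[a1 al].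
have ev j : 0 < j <= 2 * k -> a (2 * j) != 0.
  by move=> hj; rewrite color1_parity ?(negPf a2) /=; lia.
have step j : 0 < j < 2 * k -> a (2 * j) != a (2 * j.+1).
  move=> hj; apply/eqP => e; have := a_far (i := 2 * j) (j := 2 * j.+1).
  by have := ev j; lia.
have alt j : 0 < j <= 2 * k -> a (2 * j) = if odd j then 2 else 1.
  elim: j => [|j IH] // hj; have := a_lt3 (2 * j.+1); have := ev j.+1 hj.
  have [->|j0] := posnP j.
    have := ev 2; have := step 1; have := a_lt3 (2 * 2); have := a_lt3 1.
    have := a_far (i := 1) (j := 2); have := a_far (i := 1) (j := 4).
    rewrite -[2 * 2]/4 muln1 /=; move: (a 1) (a 2) (a 4) a1 => x y z.
    by clear -hj lE; lia.
  have := step j; by rewrite IH /=; [case: (odd j) => /=|]; lia.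
have := alt (2 * k); have := ev (2 * k).-1; have := alt (2 * k).-1.
have := a_far (i := 4 * k) (j := l); have := a_far (i := 4 * k - 2) (j := l).
have := a_lt3 l; have -> : 2 * (2 * k) = 4 * k by lia.
have -> : 2 * (2 * k).-1 = 4 * k - 2 by lia.
have -> : odd (2 * k).-1 by lia.
have -> : odd (2 * k) = false by lia.
lia.
Qed.

End Alternation.

Section Caterpillar.

Variables (l : nat) (m : nat -> nat).
Local Notation G := (caterpillar l m).

(* The index in w_0 ... w_(l+1), extended to all leaves: those of v_1 sit at 0,
   those of v_l at l + 1, and any other leaf at the index of its neighbor. *)
Definition cat_pos (x : cat_vertex l m) : nat :=
  match x with
  | inl i => i.+1
  | inr a => if tag a == 0 :> nat then 0
             else if (tag a).+1 == l then l.+1 else (tag a).+1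
  end.

Lemma cat_pos_lipschitz (x y : G) : adj x y -> cat_pos y <= (cat_pos x).+1.
Proof.
case: x y => [i|[i s]] [j|[j t]] //=; first by lia.
- by move=> /eqP->; case: ifP; [|case: ifP]; lia.
- by move=> /eqP<-; case: ifP; [|case: ifP]; lia.
Qed.

Lemma cat_pos_le (x : G) : cat_pos x <= l.+1.
Proof.
case: x => [i|[i s]] /=; have := ltn_ord i; first by lia.
by case: ifP; [|case: ifP]; lia.
Qed.

Section FromSequence.

Variable a : nat -> nat.
Hypothesis l_ge2 : 2 <= l.
Hypothesis a_lt3 : forall i, a i < 3.
Hypothesis a_proper : forall i, 1 <= i < l -> a i = 0 -> a i.+1 != 0.
Hypothesis a_far :
  forall i j, i < j <= l.+1 -> a i = a j -> a i != 0 -> a i + 2 <= j - i.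
Hypothesis a_leaf : forall i, 1 <= i <= l -> a i = 0 -> m i <= (i == 1) + (i == l).
Hypothesis a_first : a 1 = 0 -> a 0 != 0.
Hypothesis a_last : a l = 0 -> a l.+1 != 0.

Definition cat_color (x : cat_vertex l m) : nat :=
  match x with
  | inl i => a i.+1
  | inr b => if a (tag b).+1 == 0 then a (cat_pos x) else 0
  end.

Lemma cat_color_pos (x : G) : cat_color x != 0 -> cat_color x = a (cat_pos x).
Proof. by case: x => [i|b] //=; case: ifP. Qed.

Lemma cat_color_leaf (b : {i : 'I_l & 'I_(m i.+1)}) :
  cat_color (inr b) != 0 ->
  (tag b = 0 :> nat \/ (tag b).+1 = l) /\ tagged b = 0 :> nat.
Proof.
case: b => [i s] /=; case: ifP => // /eqP ai0 _.
have := a_leaf (i := i.+1); rewrite ltn_ord /= => /(_ isT ai0).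
by have := ltn_ord s; case: eqP; case: eqP; lia.
Qed.

Lemma cat_pos_inj (x y : G) :
  cat_color x != 0 -> cat_color y != 0 -> cat_pos x = cat_pos y -> x = y.
Proof.
case: x y => [i|[i s]] [j|[j t]] cx cy.
- by move=> /= [] ij; congr inl; apply: val_inj.
- have [h _] := cat_color_leaf cy; move: h => /= h.
  have := ltn_ord i; case: eqP => //; case: eqP => //; try lia.
- have [h _] := cat_color_leaf cx; move: h => /= h.
  have := ltn_ord j; case: eqP => //; case: eqP => //; try lia.
- have [hx sx] := cat_color_leaf cx; have [hy sy] := cat_color_leaf cy.
  move: hx sx hy sy => /= hx sx hy sy pxy.
  have ij : i = j.
    by apply: val_inj; move: pxy => /=; do 4?case: eqP; lia.
  subst j; congr (inr (existT _ i _)); apply: val_inj; rewrite /= sx sy //.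
Qed.

Lemma cat_color_proper (x y : G) : adj x y -> cat_color x = 0 -> cat_color y != 0.
Proof.
have leaf_bb (i : 'I_l) (s : 'I_(m i.+1)) : a i.+1 = 0 ->
    cat_color (inr (existT _ i s)) != 0.
  move=> ai0; rewrite /= ai0 /=.
  have := a_leaf (i := i.+1); rewrite ltn_ord /= => /(_ isT ai0).
  have := ltn_ord s; have [i0 _ _|i0] := eqVneq (i : nat) 0.
    by apply: a_first; move: ai0; rewrite i0.
  have [il _ _|il] := eqVneq i.+1 l; last by lia.
  by apply: a_last; rewrite -il.
case: x y => [i|[i s]] [j|[j t]] //.
- have := ltn_ord i; have := ltn_ord j => /= hj hi /orP[]/eqP ij ai.
    by rewrite -ij; apply: a_proper => //; lia.
  by apply/eqP => aj; have := @a_proper j.+1; rewrite aj ij ai => /(_ _ erefl); lia.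
- by move=> /eqP /= ji ai; apply: (leaf_bb j t); rewrite ji.
- move=> /= /eqP<- ; case: ifP => [/eqP ai0 h|/negbT //].
  by have := leaf_bb i s ai0; rewrite /= ai0 h.
Qed.

Lemma cat_packing_colorable : packing_colorable G 3.
Proof.
have lt3 x : cat_color x < 3 by case: x => [i|b] //=; case: ifP.
apply/existsP; exists [ffun x => Ordinal (lt3 x)].
apply/forallP=> u; apply/forallP=> v; apply/implyP=> /and3P[uv].
rewrite !ffunE -val_eqE /= => /eqP c_uv /walk_gdist.
set n := gdist u v => w_uv; rewrite addSnnS.
have [c0|c0] := eqVneq (cat_color u) 0.
  case/walkP: w_uv => -[|x [|y p]] [<- //=]; first by move=> _ e; rewrite e eqxx in uv.
    by rewrite andbT => ux e; have := cat_color_proper ux c0; rewrite e -c_uv c0.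
  by rewrite c0.
have c0' : cat_color v != 0 by rewrite -c_uv.
have neq : cat_pos u != cat_pos v by apply: contra_neq uv; exact: cat_pos_inj.
have [lip1 lip2] := walk_lipschitz cat_pos_lipschitz w_uv.
have cu := cat_color_pos c0; have cv := cat_color_pos c0'.
have := cat_pos_le u; have := cat_pos_le v => hv hu.
case: (ltngtP (cat_pos u) (cat_pos v)) neq => // lt_uv _.
  by have := @a_far (cat_pos u) (cat_pos v); lia.
by have := @a_far (cat_pos v) (cat_pos u); lia.
Qed.

End FromSequence.

Section LongestPath.

Hypothesis l_ge2 : 2 <= l.
Hypothesis m1_gt0 : 0 < m 1.
Hypothesis ml_gt0 : 0 < m l.

Lemma cat_longest_path : exists w : nat -> G,
  [/\ forall i, i <= l -> adj (w i) (w i.+1),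
      forall i j, i <= l.+1 -> j <= l.+1 -> w i = w j -> i = j
    & forall i, 1 <= i <= l -> (i == 1) + (i == l) < m i ->
        exists x, [/\ adj (w i) x, x != w i.-1 & x != w i.+1]].
Proof.
have lt0 : 0 < l by lia.
have ltl : l.-1 < l by lia.
have ml' : 0 < m (l.-1).+1 by rewrite prednK.
pose o0 := Ordinal lt0; pose ol := Ordinal ltl.
pose w i : cat_vertex l m :=
  if i == 0 then inr (existT (fun i : 'I_l => 'I_(m i.+1)) o0 (Ordinal m1_gt0))
  else if i == l.+1 then
    inr (existT (fun i : 'I_l => 'I_(m i.+1)) ol (Ordinal ml'))
  else inl (insubd o0 i.-1).
have posw i : i <= l.+1 -> cat_pos (w i) = i.
  move=> hi; rewrite /w; case: (i =P 0) => [->|i0] //=.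
  case: (i =P l.+1) => [->|il] /=; first by case: eqP; [|case: eqP]; lia.
  by rewrite val_insubd; case: ifP; lia.
have wE i (hi : 1 <= i <= l) : exists2 o : 'I_l, o.+1 = i & w i = inl o.
  have hi' : i.-1 < l by lia.
  exists (Ordinal hi'); first by rewrite /=; lia.
  rewrite /w; case: eqP; first lia; case: eqP; first lia.
  by move=> _ _; congr inl; apply: val_inj; rewrite val_insubd hi'.
exists w; split.
- move=> i hi; case: (posnP i) => [->|i0].
    by have [o oE ->] := wE 1 ltac:(lia); rewrite /= /w /= -val_eqE /=; lia.
  have [o oE ->] := wE i ltac:(lia); case: (ltngtP i l) hi => // [il|il] _.
    have [o' oE' ->] := wE i.+1 ltac:(lia); rewrite /=; lia.
  by rewrite il /w /= eqxx -val_eqE /=; lia.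
- by move=> i j /posw {2}<- /posw {2}<- ->.
- move=> i hi mi; have [o oE wi] := wE i hi.
  have hs : (i == 1) + (i == l) < m o.+1 by rewrite oE.
  pose x : G := inr (existT (fun i : 'I_l => 'I_(m i.+1)) o (Ordinal hs)).
  have out j b : w j = inr b -> (i == 1) + (i == l) != tagged b :> nat -> x != w j.
    by move=> -> ; apply: contraNneq => -[<-].
  have px : cat_pos x = if i == 1 then 0 else if i == l then l.+1 else i.
    by rewrite /= -oE; do 4?case: eqP; lia.
  have far j : j <= l.+1 -> cat_pos x != j -> x != w j.
    by move=> hj; apply: contraNneq => ->; rewrite posw.
  exists x; rewrite wi /=; split=> //.
    have [i1|i1] := eqVneq i 1; last by apply: far; rewrite ?px ?(negPf i1); do ?case: ifP; lia.
    by apply: (out i.-1); [rewrite i1 /w /=|rewrite i1 /=].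
  have [il|il] := eqVneq i l; last by apply: far; rewrite ?px ?(negPf il); do ?case: ifP; lia.
  by apply: out; [rewrite il /w /= eqxx|rewrite il /= eqxx addn1].
Qed.

Lemma path_walk (w : nat -> G) :
  (forall i, i <= l -> adj (w i) (w i.+1)) ->
  forall n i, i + n <= l.+1 -> walk n (w i) (w (i + n)).
Proof.
move=> w_adj; elim=> [|n IH] i hi; first by rewrite addn0 walk0.
rewrite addnS -addSn; apply: walk_cons (IH i.+1 _); last by lia.
by apply: w_adj; lia.
Qed.

Lemma packing_coloring_sequence k : k <= 3 -> packing_colorable G k ->
  exists a : nat -> nat,
  [/\ forall i, a i < k,
      forall i j, i < j <= l.+1 -> a i = a j -> a i + 2 <= j - i
    & forall i, 1 <= i <= l -> (i == 1) + (i == l) < m i -> a i != 0].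
Proof.
move=> k3 /existsP[c pc].
have [w [w_adj w_inj w_third]] := cat_longest_path.
have a_far i j : i < j <= l.+1 -> c (w i) = c (w j) -> c (w i) + 2 <= j - i.
  move=> /andP[ij jl] cij; apply: packing_far pc _ _ cij.
    by apply/eqP=> /w_inj; lia.
  have {2}-> : j = i + (j - i) by lia.
  by apply: path_walk => //; lia.
exists (fun i => nat_of_ord (c (w i))); split=> [i|i j ij /val_inj cij|i hi mi].
- exact: ltn_ord.
- exact: a_far.
have [x [wx x1 x2]] := w_third i hi mi; apply/eqP => ci0.
have w1 : adj (w i.-1) (w i) by have := w_adj i.-1; rewrite prednK; [apply; lia|lia].
have w2 : adj (w i) (w i.+1) by apply: w_adj; lia.
have adj_neq (u v : G) : adj u v -> c u = 0 :> nat -> c v != 0 :> nat.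
  move=> uv cu0; apply/eqP=> cv0.
  have cuv : c u = c v by apply: val_inj; rewrite /= cu0 cv0.
  have neq : u != v by apply: contraTneq uv => ->; rewrite adj_irrefl.
  have := packing_far pc neq (walk_cons uv (walk0 v)) cuv.
  by rewrite cu0.
have two (u v : G) : adj u (w i) -> adj (w i) v -> u != v ->
    c u != 0 :> nat -> c u != c v :> nat.
  move=> ui iv uv cu0; apply: contraNneq cu0 => /val_inj cuv.
  have := packing_far pc uv (walk_cons ui (walk_cons iv (walk0 v))) cuv.
  by rewrite addn2 !ltnS leqn0.
have neq : w i.-1 != w i.+1 by apply/eqP=> /w_inj; lia.
have xw : adj x (w i) by rewrite adj_sym.
have w1' : adj (w i) (w i.-1) by rewrite adj_sym.
have cx := adj_neq _ _ wx ci0; have c1 := adj_neq _ _ w1' ci0.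
have c2 := adj_neq _ _ w2 ci0.
have := two _ _ xw w1' x1 cx; have := two _ _ xw w2 x2 cx.
have := two _ _ w1 w2 neq c1.
have := ltn_ord (c x); have := ltn_ord (c (w i.-1)); have := ltn_ord (c (w i.+1)).
move: (nat_of_ord (c x)) (nat_of_ord (c (w i.-1))) (nat_of_ord (c (w i.+1))) cx c1 c2.
by clear -k3; lia.
Qed.

Lemma not_packing_colorable2 k : k < 3 -> ~~ packing_colorable G k.
Proof.
move=> k3; apply/negP=> /packing_coloring_sequence[|a [a_lt a_far _]]; first lia.
have a_lt2 i : a i < 2 by apply: leq_trans (a_lt i) _; lia.
have := color_neq1 a_far (i := 0) ltac:(lia).
have := color_neq1 a_far (i := 1) ltac:(lia).
have := color_neq1 a_far (i := 2) ltac:(lia).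
have := color_neq2 a_far (i := 0) ltac:(lia).
have := color_neq2 a_far (i := 1) ltac:(lia).
move: (a_lt2 0) (a_lt2 1) (a_lt2 2) (a_lt2 3).
by move: (a 0) (a 1) (a 2) (a 3); do 4!case=> [|[|?]] //=; intuition.
Qed.

Lemma cat_packing_chromatic3 :
  packing_chromatic G = 3 <-> packing_colorable G 3.
Proof.
split=> [|G3]; last by apply: packing_chromatic_eq => // k /not_packing_colorable2.
by rewrite /packing_chromatic; case: ex_minnP => n + _ nE; rewrite nE.
Qed.

End LongestPath.

End Caterpillar.

Section Reversal.

Variables (l : nat).

Definition cat_rev m m' (e : forall i : 'I_l, m i.+1 = m' (rev_ord i).+1)
    (x : cat_vertex l m) : cat_vertex l m' :=
  match x with
  | inl i => inl (rev_ord i)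
  | inr (existT i s) =>
      inr (existT (fun i : 'I_l => 'I_(m' i.+1)) (rev_ord i) (cast_ord (e i) s))
  end.

Lemma cat_rev_inj m m' (e : forall i : 'I_l, m i.+1 = m' (rev_ord i).+1) :
  injective (cat_rev e).
Proof.
have inr_inj := @inr_inj 'I_l {i : 'I_l & 'I_(m' i.+1)}.
move=> [i|[i s]] [j|[j t]] //= h.
  by case: h => h; congr inl; apply: rev_ord_inj; apply: val_inj.
have {}h := inr_inj _ _ h.
have ij : i = j by have := congr1 tag h; exact: rev_ord_inj.
by subst j; move/eqP: h; rewrite eq_Tagged => /eqP/cast_ord_inj->.
Qed.

Lemma isomorphic_cat_rev m :
  isomorphic (caterpillar l m) (caterpillar l (fun i => m (l.+1 - i))).
Proof.
set m' := fun i => _.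
have e (i : 'I_l) : m i.+1 = m' (rev_ord i).+1.
  by rewrite /m' /=; congr m; have := ltn_ord i; lia.
have e' (i : 'I_l) : m' i.+1 = m (rev_ord i).+1.
  by rewrite /m' /=; congr m; have := ltn_ord i; lia.
exists (cat_rev e).
  apply: inj_card_bij (@cat_rev_inj _ _ e) _.
  exact: leq_card (@cat_rev_inj _ _ e').
move=> [i|[i s]] [j|[j t]] //=; rewrite ?(inj_eq rev_ord_inj) //.
by have := ltn_ord i; have := ltn_ord j; lia.
Qed.

End Reversal.

Section ExplicitColorings.

Variables (l : nat) (m : nat -> nat).
Hypothesis l_ge2 : 2 <= l.

Lemma colorable_even : ~~ odd l ->
  (forall i, odd i -> 3 <= i <= l - 1 -> m i = 0) ->
  packing_colorable (caterpillar l m) 3.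
Proof.
move=> l_even m0.
pose a i := if i == 1 then 1 else if (i == 0) || odd i then 0
            else if i %% 4 == 2 then 2 else 1.
apply: (@cat_packing_colorable l m a) => //; rewrite /a.
- by move=> i; do 3?case: ifP.
- by move=> i; do 6?case: ifP; lia.
- by move=> i j; do 6?case: ifP; lia.
- by move=> i hi ai; rewrite m0 //; move: ai; do 3?case: ifP; lia.
- by do 6?case: ifP; lia.
Qed.

Lemma colorable_leafless_even : odd l ->
  (forall i, ~~ odd i -> 2 <= i <= l - 1 -> m i = 0) ->
  packing_colorable (caterpillar l m) 3.
Proof.
move=> l_odd m0.
pose a i := if ~~ odd i then 0 else if i %% 4 == 1 then 1 else 2.
apply: (@cat_packing_colorable l m a) => //; rewrite /a.
- by move=> i; do 2?case: ifP.
- by move=> i; do 4?case: ifP; lia.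
- by move=> i j; do 4?case: ifP; lia.
- by move=> i hi ai; rewrite m0 //; move: ai; do 2?case: ifP; lia.
- by do 4?case: ifP; lia.
Qed.

Lemma colorable_mod4_3 : l %% 4 = 3 -> l != 3 ->
  (forall i, odd i -> 3 <= i <= l - 2 -> m i = 0) ->
  packing_colorable (caterpillar l m) 3.
Proof.
move=> l_mod l3 m0.
pose a i := if (i == 1) || (i == l) then 1
            else if [|| i == 0, odd i | i == l.+1] then 0
            else if i %% 4 == 2 then 2 else 1.
apply: (@cat_packing_colorable l m a) => //; rewrite /a.
- by move=> i; do 3?case: ifP.
- by move=> i; do 6?case: ifP; lia.
- by move=> i j; do 6?case: ifP; lia.
- by move=> i hi ai; rewrite m0 //; move: ai; do 3?case: ifP; lia.
- by do 6?case: ifP; lia.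
Qed.

Lemma colorable_mod4_1 : l %% 4 = 1 -> m 1 = 1 ->
  (forall i, odd i -> 3 <= i <= l - 2 -> m i = 0) ->
  packing_colorable (caterpillar l m) 3.
Proof.
move=> l_mod m1 m0.
pose a i := if i == l then 1 else if odd i || (i == l.+1) then 0
            else if i %% 4 == 0 then 2 else 1.
apply: (@cat_packing_colorable l m a) => //; rewrite /a.
- by move=> i; do 3?case: ifP.
- by move=> i; do 6?case: ifP; lia.
- by move=> i j; do 6?case: ifP; lia.
- move=> i hi ai; have [->|i1] := eqVneq i 1; first by rewrite m1.
  by rewrite m0 //; move: ai; do 3?case: ifP; lia.
- by do 6?case: ifP; lia.
- by rewrite eqxx.
Qed.

End ExplicitColorings.

Lemma colorable_3 m : m 3 = 1 -> packing_colorable (caterpillar 3 m) 3.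
Proof.
move=> m3.
apply: (@cat_packing_colorable 3 m (nth 0 [:: 0; 1; 2; 0; 1])) => //.
- by move=> [|[|[|[|[|i]]]]] //=; rewrite nth_nil.
- by move=> [|[|[|i]]].
- by move=> [|[|[|[|[|i]]]]] [|[|[|[|[|j]]]]] //=; lia.
- by move=> [|[|[|[|i]]]] //=; rewrite m3.
Qed.

Lemma colorable_shape (l : nat) (m : nat -> nat) :
  2 <= l -> 1 <= m 1 -> 1 <= m l -> packing_colorable (caterpillar l m) 3 ->
  let G := caterpillar l m in
  family1 G \/ family2 G \/ family3 G \/ family4 G \/ family5 G \/ family6 G \/
  family7 G.
Proof.
move=> l2 m1 ml /(packing_coloring_sequence l2 m1 ml (leqnn 3)) [a [a_lt3 a_far a_deg]] G.
have par i : 2 <= i < l -> (a i == 0) = (a 2 == 0) (+) odd i.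
  by move=> hi; exact: color1_parity hi.
have mz i : 1 < i < l -> a i == 0 -> m i = 0.
  move=> hi ai; apply/eqP; rewrite -leqn0 leqNgt; apply: contraL ai => mi.
  by apply: a_deg; first lia; case: eqP; case: eqP; lia.
have m_end i : i = 1 \/ i = l -> a i == 0 -> 1 <= m i -> m i = 1.
  move=> hi ai mi; apply/eqP; rewrite eqn_leq mi andbT leqNgt; apply: contraL ai => mi2.
  by apply: a_deg; first lia; case: eqP; case: eqP; lia.
pose m' i := m (l.+1 - i).
have m'1 : m' 1 = m l by rewrite /m' subSS subn0.
have m'l : m' l = m 1 by rewrite /m' subSnn.
have refl := isomorphic_refl G.
have rev : isomorphic G (caterpillar l m') := isomorphic_cat_rev l m.
have [l_odd|l_even] := boolP (odd l); last first.
  have [n [nz n1 nl isoG]] : exists n, [/\ forall i, odd i -> 3 <= i <= l - 1 -> n i = 0,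
      1 <= n 1, 1 <= n l & isomorphic G (caterpillar l n)].
    have [a2|a2] := boolP (a 2 == 0).
      exists m'; rewrite m'1 m'l; split=> // i i_odd hi.
      by apply: mz; [lia|rewrite par ?a2 /=; lia].
    exists m; split=> // i i_odd hi.
    by apply: mz; [lia|rewrite par ?(negPf a2) /=; lia].
  have [l4|l4] := eqVneq (l %% 4) 0.
    left; exists (l %/ 4), n; have <- : l = 4 * (l %/ 4) by lia.
    by split=> //; lia.
  do 3!right; left; exists (l %/ 4), n; have lE : l = 4 * (l %/ 4) + 2 by lia.
  by rewrite -lE; split=> // i i_odd hi; apply: nz => //; lia.
have [a2|a2] := boolP (a 2 == 0).
  have me i : ~~ odd i -> 2 <= i <= l - 1 -> m i = 0.
    by move=> i_even hi; apply: mz; [lia|rewrite par ?a2 /=; lia].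
  have [l4|l4] := eqVneq (l %% 4) 1.
    do 2!right; left; exists (l %/ 4), m; have lE : l = 4 * (l %/ 4) + 1 by lia.
    by rewrite -lE; split=> // [|i i_even hi]; [lia|apply: me => //; lia].
  do 6!right; exists (l %/ 4), m; have lE : l = 4 * (l %/ 4) + 3 by lia.
  by rewrite -lE; split=> // i i_even hi; apply: me => //; lia.
have mo i : odd i -> 3 <= i <= l - 2 -> m i = 0.
  by move=> i_odd hi; apply: mz; [lia|rewrite par ?(negPf a2) /=; lia].
have [l4|l4] := eqVneq (l %% 4) 1.
  right; left; have lE : l = 4 * (l %/ 4) + 1 by lia.
  have k0 : 0 < l %/ 4 by lia.
  have [a1|al] := orP (color1_at_an_end a_lt3 a_far k0 lE a2).
    exists (l %/ 4), m; rewrite -lE; split=> // [|i i_odd hi].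
      by split=> //; apply: m_end => //; left.
    by apply: mo => //; lia.
  exists (l %/ 4), m'; rewrite -lE; split=> // [|i i_odd hi].
    by rewrite m'1 m'l; split=> //; apply: m_end => //; right.
  by apply: mo; lia.
have [l3|l3] := eqVneq l 3.
  do 5!right; left; rewrite /family6 -[X in caterpillar X]l3.
  have [a1|a1] := boolP (a 1 == 0).
    exists m'; split=> //; first by rewrite m'1.
    by rewrite -[X in m' X]l3 m'l; apply: m_end => //; left.
  exists m; split=> //; rewrite -[X in m X]l3; apply: m_end => //; first by right.
  have := color_neq1 a_far (i := 1) ltac:(lia).
  have := color_neq1 a_far (i := 2) ltac:(lia).
  have := color_neq2 a_far (i := 1) ltac:(lia) a1.
  rewrite l3; have := a_lt3 1; have := a_lt3 2; have := a_lt3 3; lia.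
do 4!right; left; exists (l %/ 4), m; have lE : l = 4 * (l %/ 4) + 3 by lia.
rewrite -lE; split=> // [|i i_odd hi]; first by lia.
by apply: mo => //; lia.
Qed.

Theorem theorem18 (l : nat) (m : nat -> nat)
  (hl : 2 <= l) (hm1 : 1 <= m 1) (hml : 1 <= m l) :
  packing_chromatic (caterpillar l m) = 3 <->
  (family1 (caterpillar l m) \/ family2 (caterpillar l m) \/
   family3 (caterpillar l m) \/ family4 (caterpillar l m) \/
   family5 (caterpillar l m) \/ family6 (caterpillar l m) \/
   family7 (caterpillar l m)).
Proof.
rewrite cat_packing_chromatic3 //; split; first exact: colorable_shape.
case=> [[k [n [k0 _ n0 /isomorphic_packing_colorable]]]|].
  by apply; apply: colorable_even => //; lia.
case=> [[k [n [k0 [n1 _] n0 /isomorphic_packing_colorable]]]|].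
  by apply; apply: colorable_mod4_1 => // [||i i_odd hi]; [lia|lia|apply: n0 => //; lia].
case=> [[k [n [k0 _ n0 /isomorphic_packing_colorable]]]|].
  by apply; apply: colorable_leafless_even => // [||i i_even hi]; [lia|lia|apply: n0 => //; lia].
case=> [[k [n [_ n0 /isomorphic_packing_colorable]]]|].
  by apply; apply: colorable_even => // [||i i_odd hi]; [lia|lia|apply: n0 => //; lia].
case=> [[k [n [k0 _ n0 /isomorphic_packing_colorable]]]|].
  by apply; apply: colorable_mod4_3 => // [|||i i_odd hi]; [lia|lia|lia|apply: n0 => //; lia].
case=> [[n [_ n3 /isomorphic_packing_colorable]]|].
  by apply; exact: colorable_3.
case=> k [n [_ n0 /isomorphic_packing_colorable]].
by apply; apply: colorable_leafless_even => // [||i i_even hi]; [lia|lia|apply: n0 => //; lia].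
Qed.
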